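(* The distributive $(\vee,0)$-semilattice $S_{\omega_1}$ does not satisfy $\mathrm{URP_{sr}}(e)$, where $e=(\omega_1,\omega_1)$ is the largest element of $S_{\omega_1}$.
   Context: Ordinals are identified with the set of smaller ordinals; $\omega_1$ is the first uncountable ordinal. Let $\mathcal{B}_{\omega_1}$ be the interval algebra of $\omega_1$, that is, the Boolean subalgebra of the powerset of $\omega_1$ generated by all intervals of $\omega_1$. Put $\mathcal{I}_{\omega_1}=\{x\in\mathcal{B}_{\omega_1}\mid \exists\alpha<\omega_1,\ x\subseteq\alpha\}$, $\mathcal{F}_{\omega_1}=\{x\in\mathcal{B}_{\omega_1}\mid \exists\alpha<\omega_1,\ \omega_1\setminus\alpha\subseteq x\}$, $D_{\omega_1}=\{x\subseteq\omega_1\mid x\text{ is finite or }x=\omega_1\}$, and $D_{\omega_1}^-=D_{\omega_1}\setminus\{\varnothing\}$. Then $S_{\omega_1}=(\{\varnothing\}\times\mathcal{I}_{\omega_1})\cup(D_{\omega_1}^-\times\mathcal{F}_{\omega_1})$, ordered by componentwise inclusion; it is a join-semilattice (joins are componentwise unions) with least element $(\varnothing,\varnothing)$ and largest element $(\omega_1,\omega_1)$, and it is distributive, meaning that $c\leq a\vee b$ implies $c=a'\vee b'$ for some $a'\leq a$, $b'\leq b$. For a join-semilattice $S$ and $A\subseteq S$, $A^{[\wedge 2]}$ is the set of all elements of the form $\bigvee(x_p\mid p\subseteq A',\ |p|=2)$, where $A'$ is a finite subset of $A$ and $x_{\{a,a'\}}\in S$ satisfies $x_{\{a,a'\}}\leq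 a$ and $x_{\{a,a'\}}\leq a'$ for all distinct $a,a'\in A'$ (the empty join is $0$). A partially ordered set $P$ is $\aleph_0$-downward directed if for every at most countable subset $X$ of $P$ there is an element of $P$ that is $\leq x$ for all $x\in X$. For a join-semilattice $S$ and $e\in S$, $\mathrm{URP_{sr}}(e)$ is the statement: for all subsets $A,B$ of $S$ such that $A$ is uncountable, $B$ is $\aleph_0$-downward directed, and $a\leq e\leq a\vee b$ for all $(a,b)\in A\times B$, there exists $a\in A^{[\wedge 2]}$ such that $e\leq a\vee b$ for all $b\in B$. *)

(* Defs.v *)
From HB Require Import structures.
From mathcomp Require Import all_boot all_order interval finmap.
From mathcomp Require Import all_classical.
From mathcomp Require wochoice.

Set Implicit Arguments.
Unset Strict Implicit.
Unset Printing Implicit Defensive.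

Import Order.TTheory.

Local Open Scope order_scope.
Local Open Scope classical_set_scope.

(* The order type omega_1: an uncountable well-ordered set all of whose proper
   initial segments are countable. This determines the order up to isomorphism;
   [omega1] at the end of this file is a model. *)
HB.mixin Record isOmega1 (d : Order.disp_t) T of Order.Total d T := {
  omega1_wf : well_founded (fun x y : T => x < y);
  omega1_uncountable : ~ countable [set: T];
  omega1_countable_lt : forall a : T, countable [set x | x < a]
}.

#[short(type="omega1Type")]
HB.structure Definition Omega1 (d : Order.disp_t) :=
  { T of isOmega1 d T & Order.Total d T }.

Section JoinSemilattices.
Context {d : Order.disp_t}.

Definition distributive_semilattice (S : joinSemilatticeType d) : Prop :=
  forall a b c : S, (c <= a `|` b)%O ->
    exists a' b' : S, [/\ a' <= a, b' <= b & c = (a' `|` b')%O].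

Definition omega_downward_directed (P : porderType d) (B : set P) : Prop :=
  forall X : set P, X `<=` B -> countable X ->
    exists2 b, B b & forall x, X x -> b <= x.

(* A^{[/\ 2]}; the family x matters only on the two-element subsets of A'. *)
Definition wedge2 (S : bJoinSemilatticeType d) (A : set S) : set S :=
  [set s | exists (A' : {fset S}) (x : {fset S} -> S),
    [/\ [set` A'] `<=` A,
        forall a a' : S, a \in A' -> a' \in A' -> a != a' ->
          x [fset a; a']%fset <= a /\ x [fset a; a']%fset <= a'
      & s = \join_(p <- fpowerset A' | #|` p| == 2%N) x p]].

Definition URPsr (S : bJoinSemilatticeType d) (e : S) : Prop :=
  forall A B : set S,
    ~ countable A ->
    omega_downward_directed B ->
    (forall a b, A a -> B b -> a <= e /\ (e <= a `|` b)%O) ->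
    exists2 a, wedge2 A a & forall b, B b -> (e <= a `|` b)%O.

End JoinSemilattices.

Section IntervalAlgebra.
Context {d : Order.disp_t} (W : orderType d).

Definition boolean_subalgebra (M : set (set W)) : Prop :=
  [/\ M set0, M setT, setU_closed M, setI_closed M
    & forall x, M x -> M (~` x)].

Definition interval_algebra : set (set W) :=
  smallest boolean_subalgebra [set [set` i] | i in [set: interval W]].

(* With ordinals identified with their sets of predecessors, an ordinal
   alpha < omega_1 is the set of all y < alpha, where alpha : W. *)
Definition bounded_ideal : set (set W) :=
  [set x | interval_algebra x /\ exists alpha : W, x `<=` [set y | y < alpha]].

Definition cobounded_filter : set (set W) :=
  [set x | interval_algebra x /\
           exists alpha : W, ~` [set y | y < alpha] `<=` x].

Definition fin_or_full : set (set W) := [set x | finite_set x \/ x = setT].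

Definition fin_or_full_pos : set (set W) := fin_or_full `\ set0.

Definition S_set : set (set W * set W) :=
  ([set set0] `*` bounded_ideal) `|` (fin_or_full_pos `*` cobounded_filter).

Lemma interval_algebra_subalgebra : boolean_subalgebra interval_algebra.
Proof.
split=> [M [[]]//|M [[]]//|x y ix iy M MP|x y ix iy M MP|x ix M MP].
- by case: (MP) => -[_ _ MU _ _] _; apply: MU; [exact: ix|exact: iy].
- by case: (MP) => -[_ _ _ MI _] _; apply: MI; [exact: ix|exact: iy].
- by case: (MP) => -[_ _ _ _ MC] _; apply: MC; exact: ix.
Qed.

Lemma S_set_setU (p q : set W * set W) :
  S_set p -> S_set q -> S_set (p.1 `|` q.1, p.2 `|` q.2).
Proof.
have [_ _ IU _ _] := interval_algebra_subalgebra.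
have DU u v : fin_or_full u -> fin_or_full v -> fin_or_full (u `|` v).
  move=> [fu|->]; last by right; rewrite setTU.
  by move=> [fv|->]; [left; rewrite finite_setU|right; rewrite setUT].
have FU x y : interval_algebra x -> cobounded_filter y ->
    cobounded_filter (x `|` y).
  by move=> Ix [Iy [a ya]]; split; [exact: IU|exists a => z /ya; right].
case: p q => [u x] [v y] /= [] [/= Hu Hx] [] [/= Hv Hy].
- left; split=> /=; first by rewrite Hu Hv setU0.
  case: Hx Hy => Ix [a xa] [Iy [b yb]]; split; first exact: IU.
  exists (Order.max a b) => z [/xa|/yb] /= zlt.
    by rewrite lt_max zlt.
  by rewrite lt_max zlt orbT.
- right; split=> /=; first by rewrite Hu set0U.
  by apply: FU => //; case: Hx.
- right; split=> /=; first by rewrite Hv setU0.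
  by rewrite setUC; apply: FU => //; case: Hy.
- right; split=> /=; last by apply: FU => //; case: Hx.
  case: Hu Hv => Du u0 [Dv _]; split; first exact: DU.
  by move=> /= uv0; apply: u0; move: uv0; rewrite setU_eq0 => -[].
Qed.

End IntervalAlgebra.

Fact S_display : Order.disp_t. Proof. exact: Order.Disp tt tt. Qed.

Section SOmega1.
Context {d : Order.disp_t} (W : omega1Type d).

Lemma omega1_inh : exists a : W, True.
Proof.
apply: contrapT => nW; apply: (@omega1_uncountable d W).
suff -> : [set: W] = set0 by exact: countable0.
by apply/seteqP; split=> // x _; apply: nW; exists x.
Qed.

Lemma S_set_bot : S_set (@set0 W, @set0 W).
Proof.
left; split=> //=; have [I0 _ _ _ _] := @interval_algebra_subalgebra d W.
by split=> //; have [a _] := omega1_inh; exists a.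
Qed.

Lemma S_set_top : S_set ([set: W], [set: W]).
Proof.
right; have [_ IT _ _ _] := @interval_algebra_subalgebra d W.
have [a _] := omega1_inh; split; split=> //=; first by right.
  by move=> WT0; have : @set0 W a by rewrite -WT0.
by exists a.
Qed.

Definition S_omega1 : Type := set_type (@S_set d W).

HB.instance Definition _ := SubChoice.on S_omega1.

Implicit Types p q r : S_omega1.

Definition S_le p q : bool :=
  `[< (val p).1 `<=` (val q).1 /\ (val p).2 `<=` (val q).2 >].

Definition S_join p q : S_omega1 :=
  SigSub (mem_set (S_set_setU (set_mem (valP p)) (set_mem (valP q)))).

Definition S_bot : S_omega1 := SigSub (mem_set S_set_bot).

Definition S_top : S_omega1 := SigSub (mem_set S_set_top).

Lemma S_le_refl : reflexive S_le.
Proof. by move=> p; apply/asboolP; split=> x. Qed.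

Lemma S_le_anti : antisymmetric S_le.
Proof.
move=> p q /andP[/asboolP[pq1 pq2] /asboolP[qp1 qp2]]; apply: val_inj.
case: (val p) (val q) pq1 pq2 qp1 qp2 => [u x] [v y] /= *.
by congr pair; apply/seteqP.
Qed.

Lemma S_le_trans : transitive S_le.
Proof.
move=> q p r /asboolP[pq1 pq2] /asboolP[qr1 qr2]; apply/asboolP.
by split; [exact: subset_trans qr1|exact: subset_trans qr2].
Qed.

HB.instance Definition _ := Order.Le_isPOrder.Build S_display S_omega1
  S_le_refl S_le_anti S_le_trans.

Lemma S_leEsub p q :
  (p <= q) = `[< (val p).1 `<=` (val q).1 /\ (val p).2 `<=` (val q).2 >].
Proof. by []. Qed.

Lemma S_leUx p q r : (S_join p q <= r) = (p <= r) && (q <= r).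
Proof.
rewrite !S_leEsub /= !subUset; apply/asboolP/andP.
  by move=> [[? ?] [? ?]]; split; exact/asboolP.
by move=> [/asboolP[? ?] /asboolP[? ?]].
Qed.

HB.instance Definition _ :=
  Order.POrder_isJoinSemilattice.Build S_display S_omega1 S_leUx.

Lemma S_le0x p : S_bot <= p.
Proof. by rewrite S_leEsub; apply/asboolP; split=> x. Qed.

Lemma S_lex1 p : p <= S_top.
Proof. by rewrite S_leEsub; apply/asboolP; split=> x. Qed.

HB.instance Definition _ := Order.hasBottom.Build S_display S_omega1 S_le0x.
HB.instance Definition _ := Order.hasTop.Build S_display S_omega1 S_lex1.

Lemma val_S_join p q :
  val (p `|` q)%O = ((val p).1 `|` (val q).1, (val p).2 `|` (val q).2).
Proof. by []. Qed.

Lemma val_S_bot : val (\bot : S_omega1) = (set0, set0).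
Proof. by []. Qed.

Lemma val_S_top : val (\top : S_omega1) = (setT, setT).
Proof. by []. Qed.

End SOmega1.

(* A model of omega_1: in a well-ordering of the powerset of nat, the points
   with countably many predecessors. *)
Definition omega1_rel : rel (set nat) :=
  projT1 (wochoice.well_ordering_principle (set nat)).

Definition omega1_carrier : set (set nat) :=
  [set x | countable [set y | omega1_rel y x && (y != x)]].

Definition omega1 : Type := set_type omega1_carrier.
HB.instance Definition _ := SubChoice.on omega1.

Definition omega1_le (x y : omega1) : bool := omega1_rel (val x) (val y).

Lemma omega1_rel_min (A : set (set nat)) : A !=set0 ->
  exists2 z, A z & forall x, A x -> omega1_rel z x.
Proof.
move=> [x Ax]; rewrite /omega1_rel.
case: wochoice.well_ordering_principle => R Rwo /=.
have [|z [[zA zmin] _]] := Rwo (mem A); first by exists x; exact: mem_set.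
by exists z => [|y Ay]; [exact: set_mem|apply: zmin; exact: mem_set].
Qed.

Lemma omega1_rel_wo : wochoice.well_order omega1_rel.
Proof. exact: (projT2 (wochoice.well_ordering_principle (set nat))). Qed.

Lemma omega1_rel_total : total omega1_rel.
Proof.
move=> x y; have [|z [->|->] zmin] := @omega1_rel_min [set x; y].
- by exists x; left.
- by rewrite zmin//; right.
- by rewrite (zmin x) ?orbT//; left.
Qed.

Lemma omega1_rel_refl : reflexive omega1_rel.
Proof. by move=> x; have := omega1_rel_total x x; rewrite orbb. Qed.

Lemma omega1_rel_anti : antisymmetric omega1_rel.
Proof.
move=> x y /andP[xy yx].
have [|z [_ zu]] := omega1_rel_wo (A := mem [set x; y]).
  by exists x; apply: mem_set; left.
have h t : [set x; y] t -> omega1_rel t x -> omega1_rel t y ->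
    wochoice.minimum_of omega1_rel (mem [set x; y]) t.
  by move=> ? ? ?; split; [exact: mem_set|move=> s /set_mem[->|->]].
rewrite -(zu x) ?(zu y)//; apply: h => //; do ?exact: omega1_rel_refl.
  by right.
by left.
Qed.

Lemma omega1_rel_trans : transitive omega1_rel.
Proof.
move=> y x z xy yz.
have [|t [[->|->]|->] tmin] := @omega1_rel_min [set x; y; z].
- by exists x; left; left.
- by apply: tmin; right.
- have yx : omega1_rel y x by apply: tmin; left; left.
  by rewrite (omega1_rel_anti (x := x) (y := y)) ?xy.
- have zy : omega1_rel z y by apply: tmin; left; right.
  by rewrite -(omega1_rel_anti (x := y) (y := z)) ?yz.
Qed.

Fact omega1_display : Order.disp_t. Proof. exact: Order.Disp tt tt. Qed.

Lemma omega1_le_refl : reflexive omega1_le.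
Proof. by move=> x; exact: omega1_rel_refl. Qed.

Lemma omega1_le_anti : antisymmetric omega1_le.
Proof. by move=> x y /omega1_rel_anti/val_inj. Qed.

Lemma omega1_le_trans : transitive omega1_le.
Proof. by move=> x y z; exact: omega1_rel_trans. Qed.

HB.instance Definition _ := Order.Le_isPOrder.Build omega1_display omega1
  omega1_le_refl omega1_le_anti omega1_le_trans.

Lemma omega1_le_total : total (<=%O : rel omega1).
Proof. by move=> x y; exact: omega1_rel_total. Qed.

HB.instance Definition _ :=
  Order.POrder_isTotal.Build omega1_display omega1 omega1_le_total.

Lemma omega1_ltE (x y : omega1) :
  (x < y) = omega1_rel (val x) (val y) && (val x != val y).
Proof. by rewrite lt_neqAle andbC val_eqE. Qed.

Lemma omega1_model_wf : well_founded (fun x y : omega1 => x < y).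
Proof.
move=> x0; apply: contrapT => nx0.
pose A := [set val x | x in [set x : omega1 | ~ Acc (fun x y => x < y) x]].
have [|_ [z /= nz <-] zmin] := @omega1_rel_min A; first by exists (val x0), x0.
apply: nz; constructor => y yz; apply: contrapT => ny.
have zy : z <= y by apply: zmin; exists y.
by move: yz; rewrite ltNge zy.
Qed.

Lemma omega1_model_lt (a : omega1) : countable [set x | x < a].
Proof.
have ca : countable [set y | omega1_rel y (val a) && (y != val a)].
  exact: set_mem (valP a).
have [f finj] := countable_injP _ ca.
apply/countable_injP; exists (f \o val) => x y /set_mem xa /set_mem ya /= fxy.
apply: val_inj; apply: finj => //; apply: mem_set => /=.
  by rewrite -omega1_ltE.
by rewrite -omega1_ltE.
Qed.

Lemma uncountable_set_nat : ~ countable [set: set nat].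
Proof.
move=> /countable_injP[f finj].
pose D := [set n | exists2 A : set nat, f A = n & ~ A n].
have nD : ~ D (f D).
  move=> DfD; have [A fA nA] := DfD; apply: nA.
  by rewrite (finj A D) ?in_setT.
by apply: (nD); exists D.
Qed.

Lemma omega1_model_uncountable : ~ countable [set: omega1].
Proof.
move=> ct.
have cC : countable omega1_carrier.
  have [f finj] := countable_injP _ ct.
  pose g x := if pselect (omega1_carrier x) is left h
              then f (SigSub (mem_set h) : omega1) else 0%N.
  apply/countable_injP; exists g => x y /set_mem Cx /set_mem Cy.
  rewrite /g; case: pselect => // hx; case: pselect => // hy.
  by move=> /finj-/(_ (in_setT _) (in_setT _)) /(congr1 val).
apply: uncountable_set_nat; suff <- : omega1_carrier = setT by [].
apply/seteqP; split=> // x _; apply: contrapT => nx.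
have [|z nz zmin] := @omega1_rel_min (~` omega1_carrier); first by exists x.
apply: nz; apply: sub_countable cC; apply: subset_card_le => y /= /andP[yz nyz].
apply: contrapT => /zmin zy; move/eqP: nyz; apply.
by apply: omega1_rel_anti; rewrite yz.
Qed.

HB.instance Definition _ := isOmega1.Build omega1_display omega1
  omega1_model_wf omega1_model_uncountable omega1_model_lt.

(* Main.v *)
Require Import Defs.
From HB Require Import structures.
From mathcomp Require Import all_boot all_order interval finmap.
From mathcomp Require Import all_classical.

Set Implicit Arguments.
Unset Strict Implicit.
Unset Printing Implicit Defensive.

Import Order.TTheory.

Local Open Scope order_scope.
Local Open Scope classical_set_scope.

(* Failure of URP_sr: take A = {({xi}, W)} and B = {(W, W \ beta)}. An element
   below two distinct elements of A has empty first component, hence bounded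
   second component; so has every element of A^{[/\ 2]}, whose join with
   (W, W \ beta) therefore misses a point as soon as beta is large enough.
   Distributivity: if c <= a \/ b, meet c with a and with b componentwise. This
   leaves S only when, say, the first components of c and a are disjoint
   although that of c is nonempty; the second component of b is then cobounded,
   and removing it from that of the meet with a makes the latter bounded. *)

Lemma interval_algebra_ltset (d : Order.disp_t) (W : orderType d) (a : W) :
  interval_algebra [set y | y < a].
Proof.
by move=> M [_]; apply; exists `]-oo, a[%O.
Qed.

Lemma cardfs_eq2 (K : choiceType) (A : {fset K}) :
  #|` A| = 2%N -> exists a b, a != b /\ A = [fset a; b]%fset.
Proof.
move=> A2; have /fset0Pn[a aA] : A != fset0 by rewrite -cardfs_gt0 A2.
move: A2; rewrite (cardfsD1 a) aA add1n => -[] /eqP /cardfs1P [b Ab].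
exists a, b; split; last by rewrite -(fsetD1K aA) Ab.
by have := fset11 b; rewrite -Ab !inE eq_sym => /andP[].
Qed.

Section Omega1.
Context {d : Order.disp_t} (W : omega1Type d).

(** If no point lies strictly above all of [X], the closed initial segments ending at the points of
    [X] cover [W], which would then be a countable union of countable sets. *)
Lemma omega1_countable_ub (X : set W) :
  countable X -> exists b, forall x, X x -> x < b.
Proof.
move=> cX; apply: contrapT => nb; apply: (@omega1_uncountable d W).
suff -> : [set: W] = \bigcup_(x in X) (x |` [set y | y < x]).
  apply: bigcup_countable => // x _.
  (* The binary union is read as a sequence whose terms after the second are empty. *)
  rewrite -bigcup2E; apply: bigcup_countable => // -[|[|i]] _ /=.
  - exact: countable1.
  - exact: omega1_countable_lt.
  - exact: countable0.
apply/seteqP; split=> // b _; apply: contrapT => nX; apply: nb; exists b => x Xx.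
rewrite ltNge le_eqVlt; apply/negP => /orP[/eqP bx|bx]; apply: nX.
  by exists x => //; left.
by exists x => //; right.
Qed.

Definition S_of (p : set W * set W) (Sp : S_set p) : S_omega1 W :=
  SigSub (mem_set Sp).

Lemma S_leP (p q : S_omega1 W) :
  reflect ((val p).1 `<=` (val q).1 /\ (val p).2 `<=` (val q).2) (p <= q).
Proof. exact: asboolP. Qed.

Lemma fin_or_fullI (u v : set W) :
  fin_or_full u -> fin_or_full v -> fin_or_full (u `&` v).
Proof.
move=> [fu|->]; first by left; exact: sub_finite_set fu.
by rewrite setTI.
Qed.

Lemma cobounded_filterI (x y : set W) :
  cobounded_filter x -> cobounded_filter y -> cobounded_filter (x `&` y).
Proof.
have [_ _ _ II _] := @interval_algebra_subalgebra d W.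
move=> [Ix [a ax]] [Iy [b yb]]; split; first exact: II.
exists (Order.max a b) => z /= /negP; rewrite lt_max negb_or => /andP[za zb].
by split; [apply: ax|apply: yb]; exact/negP.
Qed.

Lemma bounded_idealS (x y : set W) :
  bounded_ideal y -> interval_algebra x -> x `<=` y -> bounded_ideal x.
Proof.
by move=> [_ [a ya]] Ix xy; split=> //; exists a; exact: subset_trans ya.
Qed.

Lemma cobounded_filterC (x : set W) :
  cobounded_filter x -> bounded_ideal (~` x).
Proof.
have [_ _ _ _ IC] := @interval_algebra_subalgebra d W.
move=> [Ix [a ax]]; split; first exact: IC.
by exists a => z nxz; apply: contrapT => nza; apply: nxz; exact: ax.
Qed.

Lemma S_set_algebra (p : S_omega1 W) : interval_algebra (val p).2.
Proof. by case: (set_mem (valP p)) => -[_ []]. Qed.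

Lemma S_set_fin_or_full (p : S_omega1 W) : fin_or_full (val p).1.
Proof.
case: (set_mem (valP p)) => -[/=]; last by case.
by move=> -> _; left; exact: finite_set0.
Qed.

(** The two halves of [S_set] are disjoint, so emptiness of the first component decides between the
    ideal and the filter. *)
Lemma S_set_bounded (p : S_omega1 W) :
  (val p).1 = set0 -> bounded_ideal (val p).2.
Proof. by move=> p0; case: (set_mem (valP p)) => -[//] /= []. Qed.

Lemma S_set_cobounded (p : S_omega1 W) :
  (val p).1 <> set0 -> cobounded_filter (val p).2.
Proof. by move=> p0; case: (set_mem (valP p)) => -[//]. Qed.

(** Reduces each case of distributivity to exhibiting two pairs of sets and checking their
    membership in [S_set]. *)
Lemma S_omega1_split (a b c : S_omega1 W) (p q : set W * set W) :
  S_set p -> S_set q ->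
  p.1 `<=` (val a).1 -> p.2 `<=` (val a).2 ->
  q.1 `<=` (val b).1 -> q.2 `<=` (val b).2 ->
  (val c).1 = p.1 `|` q.1 -> (val c).2 = p.2 `|` q.2 ->
  exists a' b' : S_omega1 W, [/\ a' <= a, b' <= b & c = (a' `|` b')%O].
Proof.
move=> Sp Sq pa1 pa2 qb1 qb2 c1 c2; exists (S_of Sp), (S_of Sq).
split; [exact/S_leP|exact/S_leP|].
by apply: val_inj; rewrite val_S_join /= -c1 -c2 -surjective_pairing.
Qed.

Lemma S_omega1_split_disjoint (a b c : S_omega1 W) :
  (c <= a `|` b)%O -> (val c).1 <> set0 -> (val c).1 `&` (val a).1 = set0 ->
  exists a' b' : S_omega1 W, [/\ a' <= a, b' <= b & c = (a' `|` b')%O].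
Proof.
have [_ _ _ II IC] := @interval_algebra_subalgebra d W.
move=> /S_leP[/= cab1 cab2] c0 ca0.
have cb : (val c).1 `<=` (val b).1.
  move=> z cz; case: (cab1 _ cz) => // az; exfalso.
  by have : set0 z by rewrite -ca0.
have Fb : cobounded_filter (val b).2.
  by apply: S_set_cobounded => b0; apply: c0; rewrite -subset0 -b0.
have Fc := S_set_cobounded c0.
apply: (@S_omega1_split a b c
  (set0, ((val c).2 `&` (val a).2) `&` ~` (val b).2)
  ((val c).1, (val c).2 `&` (val b).2)) => //=.
- left; split=> //=; apply: (bounded_idealS (cobounded_filterC Fb)) => [|z []//].
  have I := S_set_algebra; exact: II _ _ (II _ _ (I c) (I a)) (IC _ (I b)).
- right; split; last exact: cobounded_filterI.
  by split=> //=; exact: S_set_fin_or_full.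
- by move=> z [[]].
- by rewrite set0U.
- apply/seteqP; split=> [z cz|z [[[]]|[]]//].
  (* Nothing is lost by the removal: points inside the second component of [b] go to the second
     piece, and the others must come from [a]. *)
  have [bz|nbz] := pselect ((val b).2 z); [by right|left].
  by case: (cab2 _ cz).
Qed.

Lemma S_omega1_distributive : distributive_semilattice (S_omega1 W).
Proof.
have [_ _ _ II _] := @interval_algebra_subalgebra d W.
move=> a b c cab; have /S_leP[/= cab1 cab2] := cab.
have cE1 : (val c).1 = ((val c).1 `&` (val a).1) `|` ((val c).1 `&` (val b).1).
  by rewrite -setIUr; apply/esym/setIidPl.
have cE2 : (val c).2 = ((val c).2 `&` (val a).2) `|` ((val c).2 `&` (val b).2).
  by rewrite -setIUr; apply/esym/setIidPl.
have Ic := S_set_algebra c.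
(* With an empty first component, both meets inherit boundedness from [c]. *)
have [c0|c0] := pselect ((val c).1 = set0).
  have Bc := S_set_bounded c0.
  apply: (@S_omega1_split a b c (set0, (val c).2 `&` (val a).2)
    (set0, (val c).2 `&` (val b).2)) => //=.
  - left; split=> //=; apply: (bounded_idealS Bc) => [|z []//].
    exact: II _ _ Ic (S_set_algebra _).
  - left; split=> //=; apply: (bounded_idealS Bc) => [|z []//].
    exact: II _ _ Ic (S_set_algebra _).
  - by rewrite setU0.
have [ca0|ca0] := pselect ((val c).1 `&` (val a).1 = set0).
  exact: S_omega1_split_disjoint ca0.
have [cb0|cb0] := pselect ((val c).1 `&` (val b).1 = set0).
  rewrite joinC in cab.
  have [b' [a' [? ? ->]]] := S_omega1_split_disjoint cab c0 cb0.
  by exists a', b'; rewrite joinC.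
(* Both meets now have nonempty first components, so the second components of [a], [b] and [c] are
   all cobounded and the plain meets stay in [S_set]. *)
have meetS (p : S_omega1 W) : (val c).1 `&` (val p).1 <> set0 ->
    S_set ((val c).1 `&` (val p).1, (val c).2 `&` (val p).2).
  move=> cp0; right; split=> /=.
    by split=> //=; apply: fin_or_fullI; exact: S_set_fin_or_full.
  apply: cobounded_filterI; apply: S_set_cobounded => // p0.
  by apply: cp0; rewrite p0 setI0.
by apply: (S_omega1_split (meetS _ ca0) (meetS _ cb0)) => //= z [].
Qed.

Lemma S_set_singleton (x : W) : S_set ([set x], [set: W]).
Proof.
have [_ IT _ _ _] := @interval_algebra_subalgebra d W.
right; split; split=> //=; first by left.
  by move=> x0; have : @set0 W x by rewrite -x0.
by exists x.
Qed.

Lemma S_set_tail (x : W) : S_set ([set: W], ~` [set y | y < x]).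
Proof.
have [_ _ _ _ IC] := @interval_algebra_subalgebra d W.
right; split; split=> //=; first by right.
- by move=> T0; have : @set0 W x by rewrite -T0.
- by apply: IC; exact: interval_algebra_ltset.
- by exists x.
Qed.

Definition S_singleton (x : W) : S_omega1 W := S_of (S_set_singleton x).
Definition S_tail (x : W) : S_omega1 W := S_of (S_set_tail x).

Lemma S_singleton_uncountable : ~ countable (range S_singleton).
Proof.
move=> /countable_injP[f finj]; apply: (@omega1_uncountable d W).
apply/countable_injP; exists (f \o S_singleton) => x y _ _ /= fxy.
have : S_singleton x = S_singleton y.
  by apply: finj => //; apply: mem_set; [exists x|exists y].
move=> /(congr1 (fun p => (val p).1)) /= xy.
by have : [set y] x by rewrite -xy.
Qed.

(** Tails shrink as the index grows, so an upper bound of countably many indices yields a lower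
    bound of the tails. *)
Lemma S_tail_directed : omega_downward_directed (range S_tail).
Proof.
move=> X XB cX; have [a0 _] := omega1_inh W.
(* [g] picks an index for each member of [X]; [a0] is only a default value outside [X]. *)
have /choice[g gP] : forall p : S_omega1 W, exists a, X p -> S_tail a = p.
  move=> p; have [/XB[a _ ap]|nXp] := pselect (X p); first by exists a.
  by exists a0.
have [b bP] := omega1_countable_ub (sub_countable (card_image_le g X) cX).
exists (S_tail b) => [|p Xp]; first by exists b.
rewrite -(gP p Xp); apply/S_leP; split=> //= y; apply: contra_not => yg.
by apply: lt_trans yg _; apply: bP; exists p.
Qed.

Lemma S_singleton_wedge2 (s : S_omega1 W) :
  wedge2 (range S_singleton) s -> (val s).1 = set0.
Proof.
(* Keeps in the join the information that each index is a subset of [A'], so that [xP] applies. *)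
move=> [A' [x [A'A xP ->]]]; rewrite big_seq_cond.
apply: (big_ind (fun p : S_omega1 W => (val p).1 = set0)) => //.
  by move=> p q p0 q0; rewrite val_S_join /= p0 q0 setU0.
move=> p /andP[]; rewrite fpowersetE => /fsubsetP pA' /eqP/cardfs_eq2[a [a' [aa' pE]]].
have pa : a \in A' by apply: pA'; rewrite pE !inE eqxx.
have pa' : a' \in A' by apply: pA'; rewrite pE !inE eqxx orbT.
rewrite pE; have [/S_leP[xa _] /S_leP[xa' _]] := xP a a' pa pa' aa'.
have [t _ at_] := A'A _ pa; have [t' _ at'] := A'A _ pa'.
(* A point [z] of the first component would equal both [t] and [t'], forcing [a = a']. *)
apply/seteqP; split=> // z xz; move/eqP: aa'; apply.
have := xa _ xz; have := xa' _ xz.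
by rewrite -at_ -at' /= => -> ->.
Qed.

Lemma S_omega1_not_URPsr : ~ URPsr (\top : S_omega1 W).
Proof.
move=> /(_ _ _ S_singleton_uncountable S_tail_directed)[].
  move=> _ _ [x _ <-] [y _ <-]; split; first exact: lex1.
  by apply/S_leP; rewrite val_S_join /= setUT setTU.
move=> s /S_singleton_wedge2/S_set_bounded[_ [a sa]] top_le.
(* The missed point is [a] itself: it is not below its own bound, so it is outside the second
   component of [s], and [a < b] keeps it out of the tail at [b]. *)
have [b /(_ a erefl) ab] := omega1_countable_ub (countable1 a).
have /S_leP[_ /(_ a I)] := top_le (S_tail b) (ex_intro2 _ _ b I erefl).
by rewrite val_S_join /= => -[/sa/=|//]; rewrite ltxx.
Qed.

End Omega1.

Theorem theorem5p1 (d : Order.disp_t) (W : omega1Type d) :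
  distributive_semilattice (S_omega1 W) /\
  ~ URPsr (\top : S_omega1 W).
Proof.
by split; [exact: S_omega1_distributive|exact: S_omega1_not_URPsr].
Qed.
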